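(* Let $\mu$ be a finite Borel measure on $\mathbb{T}=\mathbb{R}/\mathbb{Z}$ and let $\lambda\in\mathbb{R}$ be such that $\overline{\dim}_{loc}\mu(x)\le\lambda$ for all $x\in\operatorname{supp}\mu$. Suppose in addition that for some $N\in\mathbb{N}$, $N\geq 1$, the set $\operatorname{supp}\mu^N$ has non-empty interior. Then there exists $k_0\in\mathbb{N}$ such that for all $k\ge k_0$ we have $$\overline{\dim}_{loc}\mu^{N+k}(z)\le\lambda N\quad\text{for all } z\in\mathbb{T}.$$
   Context: $\mathbb{T}$ carries the usual quotient metric and $B(x,r)$ denotes a ball. $\operatorname{supp}\mu$ is the support of $\mu$. The convolution of finite Borel measures on $\mathbb{T}$ is $(\mu*\nu)(A)=\iint\chi_A(x+y)\,d\mu(x)\,d\nu(y)$, and $\mu^k$ denotes the convolution of $\mu$ with itself $k$ times ($k$ factors, so $\mu^1=\mu$). The upper local dimension is $\overline{\dim}_{loc}\mu(x)=\limsup_{r\to0}\frac{\log(\mu(B(x,r)))}{\log r}$ for $x\in\operatorname{supp}\mu$ (with value $+\infty$ at points outside the support). *)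

(* Defs.v *)
From HB Require Import structures.
From mathcomp Require Import all_boot all_order all_algebra.
From mathcomp Require Import archimedean generic_quotient ring_quotient.
From mathcomp Require Import all_classical all_reals all_analysis.
From mathcomp Require Import lra.

Set Implicit Arguments.
Unset Strict Implicit.
Unset Printing Implicit Defensive.

Import Order.TTheory GRing.Theory Num.Theory.
Import numFieldNormedType.Exports.

Local Open Scope classical_set_scope.
Local Open Scope ring_scope.
Local Open Scope quotient_scope.

Definition int_pred (R : realType) : pred R := fun x => x \is a Num.int.
Arguments int_pred : clear implicits.

Lemma int_pred_zmod_closed (R : realType) : zmod_closed (int_pred R).
Proof. by split; [exact: rpred0|move=> x y; exact: rpredB]. Qed.

HB.instance Definition _ (R : realType) :=
  GRing.isZmodClosed.Build R (int_pred R) (@int_pred_zmod_closed R).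

Definition integers (R : realType) : zmodClosed R :=
  GRing.ZmodClosed.clone R (int_pred R) _.

Definition circle (R : realType) : Type :=
  ring_quotient.Quotient.quot (integers R).

HB.instance Definition _ (R : realType) := GRing.Zmodule.on (circle R).
HB.instance Definition _ (R : realType) := isPointed.Build (circle R) 0.

Section circle_metric.
Context {R : realType}.

Definition to_circle (a : R) : circle R :=
  \pi_(ring_quotient.Quotient.quot (integers R)) a.

Definition circle_dist (x y : circle R) : R :=
  inf [set r | exists a b : R,
    [/\ to_circle a = x, to_circle b = y & r = `|a - b|]].

Lemma to_circleK (x : circle R) : exists a, to_circle a = x.
Proof.
by exists (repr (x : ring_quotient.Quotient.quot (integers R))); exact: reprK.
Qed.

Lemma to_circle_eq (a b : R) : to_circle a = to_circle b <-> a - b \is a Num.int.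
Proof.
rewrite [_ \is a _](ring_quotient.Quotient.idealrBE (integers R)).
by split => [/eqP|/eqP].
Qed.

Let dists (x y : circle R) := [set r : R | exists a b : R,
  [/\ to_circle a = x, to_circle b = y & r = `|a - b|]].

Let dists_neq0 x y : dists x y !=set0.
Proof.
have [a ax] := to_circleK x; have [b yb] := to_circleK y.
by exists `|a - b|, a, b.
Qed.

Let dists_lb x y : lbound (dists x y) 0.
Proof. by move=> _ [a [b [_ _ ->]]]. Qed.

Let dists_inf x y : has_inf (dists x y).
Proof. by split; [exact: dists_neq0|exists 0; exact: dists_lb]. Qed.

Let circle_dist_ge0 x y : 0 <= circle_dist x y.
Proof. exact: lb_le_inf (dists_neq0 x y) (@dists_lb x y). Qed.

Lemma circle_dist_le (a b : R) :
  circle_dist (to_circle a) (to_circle b) <= `|a - b|.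
Proof. by apply: ge_inf; [exists 0; exact: dists_lb|exists a, b]. Qed.

Lemma circle_dist_lt (x y : circle R) (e : R) : circle_dist x y < e ->
  exists a b : R, [/\ to_circle a = x, to_circle b = y & `|a - b| < e].
Proof.
rewrite -subr_gt0 => /(inf_adherent)/(_ (dists_inf x y))[_ [a [b [ax yb ->]]]].
rewrite -/(circle_dist x y) subrKC => abe.
by exists a, b.
Qed.

Let circle_distxx x : circle_dist x x = 0.
Proof.
apply/eqP; rewrite eq_le circle_dist_ge0 andbT.
have [a <-] := to_circleK x.
by rewrite (le_trans (circle_dist_le a a))// subrr normr0.
Qed.

Let circle_dist_sym x y : circle_dist x y = circle_dist y x.
Proof.
by congr inf; apply/seteqP; split => _ [a [b [? ? ->]]]; exists b, a;
  rewrite distrC.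
Qed.

Let circle_dist_triangle y x z :
  circle_dist x z <= circle_dist x y + circle_dist y z.
Proof.
apply/ler_addgt0Pl => e e0.
have e20 : 0 < e / 2 by rewrite divr_gt0.
have : circle_dist x y < circle_dist x y + e / 2 by rewrite ltrDl.
move=> /circle_dist_lt[a [b [ax yb ab]]].
have : circle_dist y z < circle_dist y z + e / 2 by rewrite ltrDl.
move=> /circle_dist_lt[b' [c [yb' zc bc]]].
have cE : to_circle (c + (b - b')) = z.
  rewrite -zc; apply/to_circle_eq; rewrite addrAC subrr add0r.
  by apply/to_circle_eq; rewrite yb yb'.
rewrite -ax -cE (le_trans (circle_dist_le _ _))//.
have -> : a - (c + (b - b')) = (a - b) + (b' - c).
  by rewrite !opprD opprK [RHS]addrAC [RHS]addrC !addrA; lra.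
rewrite (le_trans (ler_normD _ _))//.
rewrite ax cE [e]splitr.
lra.
Qed.

Let circle_dist_positivity x y : circle_dist x y = 0 -> x = y.
Proof.
move=> xy0.
have : circle_dist x y < 2^-1 by rewrite xy0 invr_gt0.
move=> /circle_dist_lt[a [b [ax yb ab]]].
have [ab0|ab0] := eqVneq (a - b) 0.
  by rewrite -ax -yb; apply/to_circle_eq; rewrite ab0 rpred0.
have : circle_dist x y < `|a - b| by rewrite xy0 normr_gt0.
move=> /circle_dist_lt[a' [b' [ax' yb' ab']]].
have nI : (a - a') - (b - b') \is a Num.int.
  by apply: rpredB; apply/to_circle_eq; rewrite ?ax ?ax' ?yb ?yb'.
have nE : (a - a') - (b - b') = (a - b) - (a' - b') by lra.
have n0 : (a - a') - (b - b') = 0.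
  apply/eqP; apply: contraT => n0; have := norm_intr_ge1 nI n0.
  rewrite nE leNgt => /negP[].
  by rewrite (le_lt_trans (ler_normB _ _))//; lra.
by move: ab'; rewrite -(subr0_eq (etrans (esym nE) n0)) ltxx.
Qed.

HB.instance Definition _ := isMetric.Build R (circle R)
  circle_distxx circle_dist_positivity circle_dist_sym circle_dist_triangle.

End circle_metric.

HB.instance Definition _ (R : realType) :=
  Measurable.copy (circle R) (g_sigma_algebraType (@open (circle R))).

Section circle_measures.
Context {R : realType}.
Implicit Types mu nu : set (circle R) -> \bar R.
Local Open Scope ereal_scope.

Definition msupp mu : set (circle R) :=
  [set x | forall U, open_nbhs x U -> 0 < mu U].

(* Defined on set functions, so that it can be iterated; when [mu] and [nu] are
   finite Borel measures, this is [(mu * nu)(A)] for Borel sets [A]. *)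
Definition conv mu nu : set (circle R) -> \bar R :=
  fun A => \int[mu]_x \int[nu]_y (\1_A (x + y)%R)%:E.

(* [conv_pow mu k] is [conv mu (... (conv mu mu))] with [k] factors [mu] when
   [0 < k], by definition of [iterop]; the value at [k = 0] is the unit [\d_0]. *)
Definition conv_pow mu (k : nat) : set (circle R) -> \bar R :=
  iterop k conv mu (\d_(0%R : circle R)).

Definition upper_local_dim mu (x : circle R) : \bar R :=
  if `[< msupp mu x >] then
    limf_esup (fun r : R => lne (mu (ball x r)) / (ln r)%:E) 0%R^'+
  else +oo.

End circle_measures.

(* Main.v *)
From HB Require Import structures.
Require Import Defs.
From mathcomp Require Import all_boot all_order all_algebra.
From mathcomp Require Import all_classical all_reals all_analysis.
From mathcomp Require Import lra measurable_realfun zify.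

Import Order.TTheory GRing.Theory Num.Theory.
Import numFieldNormedType.Exports.

Local Open Scope classical_set_scope.
Local Open Scope ring_scope.
Local Open Scope ereal_scope.

(** Write [E] for the support of [mu] and [S] for that of [mu^N].

Supports add: [supp (m * n) = supp m + supp n], where the inclusion from left to
right uses that the circle is compact, so that the sum of two supports is closed.
Hence every point of [S] is a sum of [N] points of [E]. If [z = x_1 + ... + x_N]
with [x_i] in [E], then [mu^N (B(z, r))] is at least the product of the
[mu (B(x_i, r_i))] for any radii [r_i] with sum [r], so that for every
[s > lambda] there is [c > 0] with [mu^N (B(z, r)) >= c r^(s N)] for small [r].
This is the predicate [lower_scaling] ([lower_scaling_mpow]).

As [S] contains a ball, some multiple of it is the whole circle, and adding further
points of [E] keeps it so: [mu^k] has full support for all large [k]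
([msupp_mpow_eventually]).

Finally [mu^(N+k) (B(z, r))] is the integral of [mu^N (B(z - y, r))] against
[mu^k] in [y]. The set of the [y] with [z - y] in the interior of [S] is open and
nonempty, so [mu^k] charges it, and at each of its points [mu^N (B(z - y, r))] is
bounded below as above, with constants depending on [y]. By countable additivity
the constants may be taken uniform on a subset of positive [mu^k]-measure, and
integrating over that subset bounds [mu^(N+k) (B(z, r))] from below by
[c' r^(s N)] ([lower_scaling_open_conv]). Letting [s] decrease to [lambda] bounds
the local dimension.

The powers of [mu] are right-nested convolutions, while the last step splits
[mu^(N+k)] as [mu^k * mu^N]; Tonelli's theorem justifies this on balls
([mpowD_ball]), which is all that supports and local dimensions see. *)

(* The name [conv] also denotes convex combination. *)
Local Notation conv := Defs.conv.

(** * Metric, topology and Borel sets of the circle *)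

Section circle_geometry.
Context {R : realType}.
Implicit Types x y z : circle R.

Lemma to_circleD (a b : R) :
  to_circle (a + b)%R = (to_circle a + to_circle b)%R.
Proof. by rewrite /to_circle raddfD. Qed.

Lemma circle_ballP x y (r : R) :
  ball x r y <-> exists a b : R,
    [/\ to_circle a = x, to_circle b = y & (`|a - b| < r)%R].
Proof.
split=> [|[a [b [<- <- abr]]]]; first exact: circle_dist_lt.
exact: le_lt_trans (circle_dist_le a b) abr.
Qed.

Lemma ball_to_circle (a b r : R) :
  (`|a - b| < r)%R -> ball (to_circle a) r (to_circle b).
Proof. by move=> abr; apply/circle_ballP; exists a, b. Qed.

Lemma circle_ballD x y x' y' (r s : R) :
  ball x r x' -> ball y s y' -> ball (x + y)%R (r + s)%R (x' + y')%R.
Proof.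
move=> /circle_ballP[a [b [<- <- abr]]] /circle_ballP[a' [b' [<- <- abr']]].
rewrite -!to_circleD; apply: ball_to_circle.
by rewrite opprD addrACA (le_lt_trans (ler_normD _ _))// ltrD.
Qed.

Lemma circle_ball_transl z x y (r : R) :
  ball (z + x)%R r (z + y)%R <-> ball x r y.
Proof.
suff H (t u v : circle R) : ball u r v -> ball (t + u)%R r (t + v)%R.
  by split=> [/(H (- z)%R)|/H//]; rewrite !addKr.
have [c <-] := to_circleK t.
move=> /circle_ballP[a [b [<- <- abr]]].
rewrite -!to_circleD; apply: ball_to_circle.
by rewrite opprD addrACA subrr add0r.
Qed.

Lemma circle_ball_subl z x y (r : R) : ball (z - x)%R r y <-> ball z r (x + y)%R.
Proof. by rewrite -(circle_ball_transl x) subrKC. Qed.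

Lemma to_circle_unit_itv x :
  exists u : R, [/\ (0 <= u)%R, (u < 1)%R & to_circle u = x].
Proof.
have [a <-] := to_circleK x; exists (a - (Num.floor a)%:~R)%R; split.
- by rewrite subr_ge0 Num.Theory.floor_le.
- by rewrite ltrBlDl -[X in (_ + X)%R]/(1%:~R)%R -intrD Num.Theory.floorD1_gt.
- by apply/to_circle_eq; rewrite addrAC subrr add0r rpredN; exact: intr_int.
Qed.

Lemma continuous_to_circle : continuous (@to_circle R).
Proof.
move=> a; apply/cvg_ballP => e e0.
near=> b; apply: ball_to_circle.
near: b; exact: (@cvgr_dist_lt R R^o).
Unshelve. all: by end_near. Qed.

Lemma circle_compact : compact [set: circle R].
Proof.
rewrite (_ : setT = to_circle @` `[0%R, 1%R]%classic).
  apply: continuous_compact; last exact: segment_compact.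
  apply: continuous_subspaceT; exact: continuous_to_circle.
apply/seteqP; split=> // x _; have [u [u0 u1 ux]] := to_circle_unit_itv x.
by exists u => //; rewrite /= in_itv/= u0 ltW.
Qed.

Lemma continuous_circle_add :
  continuous (fun p : circle R * circle R => (p.1 + p.2)%R).
Proof.
move=> [x y]; apply/cvg_ballP => e e0.
exists (ball x (e / 2)%R, ball y (e / 2)%R).
  by split; apply: nbhsx_ballx; rewrite divr_gt0.
by move=> [x' y'] /= [? ?]; rewrite [e]splitr; exact: circle_ballD.
Qed.

Lemma circle_hausdorff : hausdorff_space (circle R).
Proof. exact: metric_hausdorff. Qed.

Lemma circle_rat_dense x (e : R) : (0 < e)%R ->
  exists q : rat, ball (to_circle (ratr q)) e x.
Proof.
move=> e0; have [a <-] := to_circleK x.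
have [q /andP[q1 q2]] : exists q : rat, (a < ratr q < a + e)%R.
  have /rat_in_itvoo[q] : (a < a + e)%R by rewrite ltrDl.
  by rewrite in_itv/= => qP; exists q.
exists q; apply: ball_to_circle; rewrite ltr_norml; apply/andP; split; lra.
Qed.

Lemma open_measurable_circle (U : set (circle R)) : open U -> measurable U.
Proof. exact: sub_sigma_algebra. Qed.

(** Restated for an abstract [U], where the topology of the circle can be rewritten
without touching the sigma-algebra that it generates. *)
Lemma circle_openW (U : set (circle R)) :
  (forall x, U x -> nbhs x U) -> open U.
Proof. by rewrite openE. Qed.

Lemma circle_open_reflect z (U : set (circle R)) :
  open U -> open [set y | U (z - y)%R].
Proof.
move=> oU; apply: circle_openW => y Uzy.
have /nbhs_ballP[e e0 eU] : nbhs (z - y)%R U by exact: open_nbhs_nbhs.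
apply/nbhs_ballP; exists e => // y' yy'; apply/eU/ball_sym.
move/(circle_ball_transl (z - y - y')%R): yy'.
by rewrite subrK addrAC subrK.
Qed.

Lemma circle_ball_open x (r : R) : open (ball x r).
Proof.
apply: circle_openW => y xry.
rewrite ballEmdist/= in xry.
apply/nbhs_ballP; exists (r - mdist x y)%R; first by rewrite /= subr_gt0.
move=> z; rewrite !ballEmdist/= ltrBrDl => /(le_lt_trans _); apply.
exact: metric_triangle.
Qed.

Lemma measurable_circle_ball x (r : R) : measurable (ball x r).
Proof. by apply: open_measurable_circle; exact: circle_ball_open. Qed.

(** Addition is measurable for the product sigma-algebra: the preimage of an open set
is a countable union of products of balls with rational centres. *)
Lemma measurable_circle_add :
  measurable_fun setT (fun p : circle R * circle R => (p.1 + p.2)%R).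
Proof.
apply: (@measurability _ _ _ _ _ _ (@open (circle R))); first by [].
move=> _ [U oU <-]; rewrite setTI.
pose D := [set u : rat * rat * nat |
  ball (to_circle (ratr u.1.1 + ratr u.1.2) : circle R)%R
    (2 * u.2.+1%:R^-1)%R `<=` U].
pose F (u : rat * rat * nat) : set (circle R * circle R) :=
  ball (to_circle (ratr u.1.1)) u.2.+1%:R^-1%R `*`
  ball (to_circle (ratr u.1.2)) u.2.+1%:R^-1%R.
rewrite (_ : _ @^-1` U = \bigcup_u (if u \in D then F u else set0)).
  apply: countable_bigcupT_measurable => // u; case: ifPn => // _.
  by apply: measurableX; exact: measurable_circle_ball.
apply/seteqP; split=> [[x y] /= Uxy|[x y] [u _]]; last first.
  case: ifPn => //; rewrite inE => uD [/= xu yu]; apply: uD.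
  rewrite to_circleD mulr_natl mulr2n; exact: circle_ballD.
have /nbhs_ballP[e e0 eU] : nbhs (x + y)%R U by exact: open_nbhs_nbhs.
have [n ne] : exists n, (4 * n.+1%:R^-1 < e)%R.
  have [n _ /(_ n (leqnn _)) nP] :
      \forall n \near \oo, (n.+1%:R^-1 < e / 4)%R.
    by apply: near_infty_natSinv_lt (PosNum (divr_gt0 e0 _)).
  by exists n; rewrite mulrC -ltr_pdivlMr.
have [p xp] := @circle_rat_dense x n.+1%:R^-1%R (ltac:(by rewrite invr_gt0)).
have [q yq] := @circle_rat_dense y n.+1%:R^-1%R (ltac:(by rewrite invr_gt0)).
exists (p, q, n) => //; rewrite ifT// inE /D/= => w pqw; apply: eU.
apply: (le_ball (ltW ne)).
have -> (t : R) : (4 * t = (t + t) + 2 * t)%R by lra.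
apply: (ball_triangle _ pqw); rewrite to_circleD.
by apply: circle_ballD; exact: ball_sym.
Qed.

End circle_geometry.

(** * Convolution of finite measures *)

Section convolution.
Context {R : realType}.
Variables m n : {finite_measure set (circle R) -> \bar R}.

Let add (p : circle R * circle R) := (p.1 + p.2)%R.

Lemma xsection_circle_add (A : set (circle R)) x :
  xsection (add @^-1` A) x = [set y | A (x + y)%R].
Proof. by rewrite xsectionE. Qed.

Lemma measurable_circle_add_preimage (A : set (circle R)) :
  measurable A -> measurable (add @^-1` A).
Proof. by move=> mA; rewrite -[X in measurable X]setTI; exact: measurable_circle_add. Qed.

Lemma measurable_circle_translate (A : set (circle R)) x :
  measurable A -> measurable [set y | A (x + y)%R].
Proof.
move=> mA; rewrite -xsection_circle_add; apply: measurable_xsection.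
exact: measurable_circle_add_preimage.
Qed.

Lemma convE (A : set (circle R)) : measurable A ->
  conv m n A = \int[m]_x n [set y | A (x + y)%R].
Proof.
move=> mA; apply: eq_integral => x _.
rewrite -[X in n X]setIT -integral_indic//.
exact: measurable_circle_translate.
Qed.

(** The convolution is the image of the product measure under addition; this gives
its countable additivity. *)
Lemma conv_product (A : set (circle R)) : measurable A ->
  conv m n A = (m \x n) (add @^-1` A).
Proof.
move=> mA; rewrite convE//; apply: eq_integral => x _.
by rewrite /= xsection_circle_add.
Qed.

Let conv0 : conv m n set0 = 0.
Proof. by rewrite conv_product// preimage_set0 measure0. Qed.

Let conv_ge0 A : 0 <= conv m n A.
Proof. by apply: integral_ge0 => x _; apply: integral_ge0 => y _; rewrite lee_fin. Qed.

Let conv_sigma_additive : semi_sigma_additive (conv m n).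
Proof.
move=> F mF tF mUF.
have mF' i := measurable_circle_add_preimage _ (mF i).
rewrite conv_product// preimage_bigcup.
under eq_fun do under eq_bigr do rewrite conv_product//.
apply: measure_semi_sigma_additive => //; last exact: bigcup_measurable.
by move=> i j _ _ [p [Fip Fjp]]; apply: (tF i j) => //; exists (add p).
Qed.

HB.instance Definition _ := isMeasure.Build _ _ _ (conv m n)
  conv0 conv_ge0 conv_sigma_additive.

Let conv_finite : fin_num_fun (conv m n).
Proof.
move=> A mA; rewrite ge0_fin_numE//.
apply: (@le_lt_trans _ _ (conv m n setT)); first by apply: le_measure; rewrite ?inE.
rewrite conv_product// preimage_setT -setXTT product_measure1E//.
rewrite lte_mul_pinfty//; first exact: fin_num_measure.
by rewrite -ge0_fin_numE//; exact: fin_num_measure.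
Qed.

HB.instance Definition _ := Measure_isFinite.Build _ _ _ (conv m n) conv_finite.

Lemma conv_ball_ge x y (r s : R) :
  m (ball x r) * n (ball y s) <= conv m n (ball (x + y)%R (r + s)%R).
Proof.
rewrite -product_measure1E; [|exact: measurable_circle_ball..].
rewrite conv_product; last exact: measurable_circle_ball.
apply: le_measure; rewrite ?inE.
- by apply: measurableX; exact: measurable_circle_ball.
- by apply: measurable_circle_add_preimage; exact: measurable_circle_ball.
- by move=> [x' y'] [/= ? ?]; exact: circle_ballD.
Qed.

Lemma conv_ball x (r : R) :
  conv m n (ball x r) = \int[m]_y n (ball (x - y)%R r).
Proof.
rewrite convE; last exact: measurable_circle_ball.
apply: eq_integral => y _; congr (n _).
by apply/seteqP; split=> w /circle_ball_subl.
Qed.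

Lemma measurable_measure_ball (x : circle R) (r : R) :
  measurable_fun setT (fun y : circle R => m (ball (x - y)%R r)).
Proof.
have -> : (fun y : circle R => m (ball (x - y)%R r)) =
    m \o xsection (add @^-1` ball x r).
  apply/funext => y /=; congr (m _); rewrite xsection_circle_add.
  by apply/seteqP; split=> w /circle_ball_subl.
apply: measurable_fun_xsection; apply: measurable_circle_add_preimage.
exact: measurable_circle_ball.
Qed.

End convolution.

(** * Supports *)

Section support.
Context {R : realType}.
Implicit Types m n : {finite_measure set (circle R) -> \bar R}.

Lemma msuppP m x :
  msupp m x <-> forall r : R, (0 < r)%R -> 0 < m (ball x r).
Proof.
split=> [mx r r0|mx U [oU Ux]].
  apply: mx; split; last exact: ballxx.
  exact: circle_ball_open.
have /nbhs_ballP[e e0 eU] : nbhs x U by exact: open_nbhs_nbhs.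
apply: (lt_le_trans (mx e e0)); apply: le_measure => //; rewrite inE.
  exact: measurable_circle_ball.
exact: open_measurable_circle.
Qed.

Lemma msupp_conv m n x y : msupp m x -> msupp n y -> msupp (conv m n) (x + y)%R.
Proof.
move=> /msuppP mx /msuppP ny; apply/msuppP => r r0.
rewrite [r]splitr; apply: lt_le_trans (conv_ball_ge _ _ _ _ _ _).
by rewrite mule_gt0 ?mx ?ny// divr_gt0.
Qed.

Lemma msupp_closed m : closed (msupp m).
Proof.
rewrite -[X in closed X]setCK; apply: open_closedC; apply: circle_openW.
move=> x /= /msuppP/existsNP[r /not_implyP[r0 /negP]].
rewrite -leNgt => mxr0.
apply/nbhs_ballP; exists (r / 2)%R; first by rewrite /= divr_gt0.
move=> y xy /msuppP/(_ (r / 2)%R); rewrite divr_gt0// => /(_ isT).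
apply/negP; rewrite -leNgt (le_trans _ mxr0)//.
apply: le_measure; rewrite ?inE; [exact: measurable_circle_ball..|].
by move=> z yz; rewrite [r]splitr; exact: ball_triangle yz.
Qed.

(** The complement of the support is covered by the countably many balls with rational
centres and radii [1/(k+1)] that are null. *)
Lemma msuppC_null m : m (~` msupp m) = 0.
Proof.
apply/eqP; rewrite eq_le measure_ge0 andbT.
pose B (u : rat * nat) : set (circle R) :=
  ball (to_circle (ratr u.1)) u.2.+1%:R^-1%R.
pose F k := if unpickle k is Some u then
  if m (B u) == 0 then B u else set0 else set0.
have F0 k : m.-negligible (F k).
  rewrite /F; case: unpickle => [u|]; last exact: negligible_set0.
  case: ifPn => [/eqP mBu|_]; last exact: negligible_set0.
  by apply/negligibleP => //; exact: measurable_circle_ball.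
have /negligibleP := @negligible_bigcup _ _ _ m F F0.
have mF k : measurable (F k).
  rewrite /F; case: unpickle => // u; case: ifPn => // _.
  exact: measurable_circle_ball.
move=> /(_ (bigcup_measurable (fun k _ => mF k))) <-.
apply: le_measure; rewrite ?inE.
- by apply: open_measurable_circle; apply: closed_openC; exact: msupp_closed.
- exact: bigcup_measurable.
move=> x /= /msuppP/existsNP[r /not_implyP[r0 /negP]]; rewrite -leNgt => mxr0.
have [k kr] : exists k, (2 * k.+1%:R^-1 < r)%R.
  have [k _ /(_ k (leqnn _)) kP] :
      \forall k \near \oo, (k.+1%:R^-1 < r / 2)%R.
    by apply: near_infty_natSinv_lt (PosNum (divr_gt0 r0 _)).
  by exists k; rewrite mulrC -ltr_pdivlMr.
have [q xq] := @circle_rat_dense R x k.+1%:R^-1%R (ltac:(by rewrite invr_gt0)).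
have FB u : m (B u) == 0 -> F (pickle u) = B u by rewrite /F pickleK => ->.
exists (pickle (q, k)); first exact: I.
suff /FB -> : m (B (q, k)) == 0 by exact: xq.
rewrite eq_le measure_ge0 andbT (le_trans _ mxr0)//.
apply: le_measure; rewrite ?inE; [exact: measurable_circle_ball..|].
move=> y /(ball_triangle (ball_sym xq)); apply: le_ball.
by rewrite (le_trans _ (ltW kr))// mulr_natl mulr2n.
Qed.

(** The sum of the supports is compact, hence closed, and it carries the
convolution. *)
Lemma msupp_conv_sub m n z : msupp (conv m n) z ->
  exists x y, [/\ msupp m x, msupp n y & z = (x + y)%R].
Proof.
move=> zmn.
pose add (p : circle R * circle R) := (p.1 + p.2)%R.
pose S := add @` (msupp m `*` msupp n).
have suppK (k : {finite_measure set (circle R) -> \bar R}) : compact (msupp k).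
  by apply: subclosed_compact circle_compact _ => //; exact: msupp_closed.
have clS : closed S.
  apply: compact_closed; first exact: circle_hausdorff.
  apply: continuous_compact; last by apply: compact_setX; exact: suppK.
  by apply: continuous_subspaceT; exact: continuous_circle_add.
have [[[x y] [mx ny] <-]|Sz] := pselect (S z); first by exists x, y.
have oS : open (~` S) by exact: closed_openC.
have : 0 < conv m n (~` S) by exact: zmn.
rewrite conv_product; last exact: open_measurable_circle.
have mC (k : {finite_measure set (circle R) -> \bar R}) : measurable (~` msupp k).
  by apply: open_measurable_circle; apply: closed_openC; exact: msupp_closed.
suff -> : (m \x n) (add @^-1` (~` S)) = 0 by rewrite ltxx.
apply: (@subset_measure0 _ _ _ (m \x n) _
  ((~` msupp m) `*` setT `|` setT `*` (~` msupp n))).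
- by apply: measurable_circle_add_preimage; exact: open_measurable_circle.
- by apply: measurableU; exact: measurableX.
- move=> [x y] /= nS; apply: contrapT => /not_orP[/not_andP[]//= + /not_andP[]//=].
  by move=> /contrapT mx /contrapT ny; apply: nS; exists (x, y).
apply: (etrans (@measureU0 _ _ _ (m \x n) _ _ _ _ _)).
- exact: measurableX.
- exact: measurableX.
- apply: (etrans (@product_measure1E _ _ _ _ R m n _ _ _ _)) => //.
  by rewrite [X in _ * X](msuppC_null n) mule0.
- apply: (etrans (@product_measure1E _ _ _ _ R m n _ _ _ _)) => //.
  by rewrite [X in X * _](msuppC_null m) mul0e.
Qed.

End support.

(** * Power lower bounds for the measure of small balls *)

Section lower_scaling.
Context {R : realType}.
Implicit Types m n : {finite_measure set (circle R) -> \bar R}.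

(** [m (B(x, r)) >= c r^s] for some [c > 0] and all small [r]. The upper local
dimension of [m] at a point [x] of its support is the infimum of the exponents [s]
with this property. *)
Definition lower_scaling (m : set (circle R) -> \bar R) (x : circle R) (s : R) :=
  exists c d : R, [/\ (0 < c)%R, (0 < d)%R &
    forall r : R, (0 < r < d)%R -> (c * r `^ s)%:E <= m (ball x r)].

Lemma upper_local_dim_scaling m x (a s : R) : msupp m x ->
  upper_local_dim m x <= a%:E -> (a < s)%R -> lower_scaling m x s.
Proof.
move=> mx; rewrite /upper_local_dim asboolT// => dima as_.
have := le_lt_trans dima (as_ : a%:E < s%:E).
move=> /ereal_inf_lt[_ [V V0 <-] Vs].
have {V0} [e /= e0 eV] : exists2 e : R, (0 < e)%R &
    forall r, (0 < r < e)%R -> V r.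
  case: V0 => e /= e0 eV; exists e => // r /andP[r0 re]; apply: eV => //=.
  by rewrite sub0r normrN gtr0_norm.
exists 1%R, (Num.min e 1%R); split => //; first by rewrite lt_min e0 ltr01.
move=> r; rewrite lt_min mul1r => /and3P[r0 re r1].
have : lne (m (ball x r)) / (ln r)%:E <= ereal_sup
    [set lne (m (ball x r)) / (ln r)%:E | r in V].
  by apply: ereal_sup_ubound; exists r => //; apply: eV; rewrite r0.
move=> /le_lt_trans/(_ Vs).
have mB0 : 0 < m (ball x r) by move/msuppP : mx; exact.
have : m (ball x r) \is a fin_num.
  by apply: fin_num_measure; exact: measurable_circle_ball.
move: mB0; case: (m (ball x r)) => // v; rewrite lte_fin => v0 _.
have lnr0 : (ln r < 0)%R by rewrite ln_lt0// r0.
rewrite lne_EFin// inver lt_eqF// -EFinM lte_fin ltr_ndivrMr// => lnv.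
by rewrite lee_fin /powR gt_eqF// -[leRHS]lnK// ler_expR ltW.
Qed.

Lemma scaling_upper_local_dim m x (a : R) : msupp m x ->
  (forall s, (a < s)%R -> lower_scaling m x s) -> upper_local_dim m x <= a%:E.
Proof.
move=> mx H; rewrite /upper_local_dim asboolT//.
apply/lee_addgt0Pr => e e0.
have [|c [d [c0 d0 cd]]] := H (a + e / 2)%R; first by rewrite ltrDl divr_gt0.
(* Below the last of these radii, [ln c / ln r] is at most [e / 2]. *)
pose d' := Num.min d (Num.min 1%R (expR (ln c * 2 / e)%R)).
have d'0 : (0 < d')%R by rewrite !lt_min d0 ltr01 expR_gt0.
have Vd : (0%R^'+ : set_system R) [set r | (0 < r < d')%R].
  exists d' => //= r /=; rewrite sub0r normrN => rd r0; rewrite r0/=.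
  exact: le_lt_trans (ler_norm _) rd.
apply: (@le_trans _ _ (ereal_sup [set lne (m (ball x r)) / (ln r)%:E |
    r in [set r | (0 < r < d')%R]])).
  by apply: ereal_inf_lbound; exists [set r | (0 < r < d')%R].
apply: ge_ereal_sup => _ [r /= /andP[r0 +] <-].
rewrite !lt_min => /and3P[rd r1 rc].
have := cd r; rewrite r0 rd => /(_ isT).
have : m (ball x r) \is a fin_num.
  by apply: fin_num_measure; exact: measurable_circle_ball.
case: (m (ball x r)) => // v _; rewrite lee_fin => cv.
have cr0 : (0 < c * r `^ (a + e / 2))%R by rewrite mulr_gt0// powR_gt0.
have v0 : (0 < v)%R by exact: lt_le_trans cv.
have lnr0 : (ln r < 0)%R by rewrite ln_lt0// r0.
rewrite lne_EFin// inver lt_eqF// -EFinM -EFinD lee_fin ler_ndivrMr//.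
have : (ln (c * r `^ (a + e / 2)) <= ln v)%R by rewrite ler_ln.
rewrite lnM ?posrE ?powR_gt0// ln_powR => lncv.
have : (ln r < ln c * 2 / e)%R by rewrite -ltr_expR lnK.
rewrite ltr_pdivlMr// => lnrc.
lra.
Qed.

(** It suffices to test the radii [1/(l+1)]: consecutive ones differ by a factor at
most 2, which costs at most the factor [2^(-|s|)] in the constant. *)
Lemma seq_scaling m x (s c : R) (i : nat) : (0 < c)%R ->
  (forall l, (i <= l)%N ->
    (c * l.+1%:R^-1 `^ s)%:E <= m (ball x l.+1%:R^-1%R)) ->
  lower_scaling m x s.
Proof.
move=> c0 H; exists (c * expR (- `|s| * ln 2))%R, i.+1%:R^-1%R.
split; rewrite ?mulr_gt0 ?expR_gt0 ?invr_gt0//.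
move=> r /andP[r0 ri].
(* [1/(l+1)] is the largest radius of the sequence that is less than [r]. *)
pose l := Num.truncn r^-1.
have /andP[l1 l2] : (l%:R <= r^-1 < l.+1%:R)%R.
  by apply: truncn_itv; rewrite invr_ge0 ltW.
have il : (i <= l)%N.
  have : (i.+1%:R < l.+1%:R :> R)%R.
    by apply: lt_trans l2; rewrite -[ltLHS]invrK ltf_pV2// posrE// invr_gt0.
  by rewrite ltr_nat ltnS => /ltnW.
have lr : (l.+1%:R^-1 <= r)%R.
  by rewrite -[leRHS]invrK lef_pV2 ?posrE ?invr_gt0// ltW.
apply: (@le_trans _ _ (m (ball x l.+1%:R^-1%R))); last first.
  apply: le_measure; rewrite ?inE; [exact: measurable_circle_ball..|].
  exact: le_ball.
apply: le_trans (H _ il).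
rewrite lee_fin -mulrA ler_pM2l// /powR !gt_eqF ?invr_gt0// -expRD ler_expR.
rewrite lnV ?posrE//.
have ge1 : (1 <= l.+1%:R * r)%R by rewrite -ler_pdivrMr// mul1r ltW.
have le2 : (l.+1%:R * r <= 2)%R.
  rewrite -natr1 mulrDl mul1r.
  have : (l%:R * r <= 1)%R by rewrite -ler_pdivlMr// mul1r.
  have : (r <= 1)%R.
    by rewrite (le_trans (ltW ri))// invf_le1// ler1n.
  lra.
have : (0 <= ln (l.+1%:R * r))%R by rewrite ln_ge0.
have : (ln (l.+1%:R * r) <= ln 2)%R by rewrite ler_ln ?posrE ?mulr_gt0.
rewrite lnM ?posrE//.
set L := ln l.+1%:R; set k := ln 2; set q := ln r => h1 h2.
rewrite (_ : s * - L = - (s * (L + q)) + s * q)%R; last by lra.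
rewrite lerD2r mulNr lerN2 (le_trans (ler_norm _))// normrM.
by rewrite (ger0_norm h2) ler_wpM2l.
Qed.

Lemma lower_scaling_conv m n x y (s t : R) :
  lower_scaling m x s -> lower_scaling n y t ->
  lower_scaling (conv m n) (x + y)%R (s + t).
Proof.
move=> [c [d [c0 d0 mx]]] [c' [d' [c'0 d'0 ny]]].
exists (c * c' * 2^-1 `^ (s + t))%R, (Num.min d d').
split; first by rewrite !mulr_gt0// powR_gt0.
  by rewrite lt_min d0.
move=> r; rewrite lt_min => /and3P[r0 rd rd'].
have r20 : (0 < r / 2)%R by rewrite divr_gt0.
have r2 : (r / 2 < r)%R by lra.
apply: (@le_trans _ _ (m (ball x (r / 2)%R) * n (ball y (r / 2)%R))); last first.
  by rewrite [in leRHS](splitr r); exact: conv_ball_ge.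
apply: (@le_trans _ _ ((c * (r / 2) `^ s)%:E * (c' * (r / 2) `^ t)%:E)).
  rewrite -EFinM lee_fin mulrACA -powRD; last by rewrite (gt_eqF r20) implybT.
  by rewrite [(r / 2)%R]mulrC powRM// ?(ltW r0)// mulrA.
apply: lee_pmul; rewrite ?lee_fin ?mulr_ge0 ?powR_ge0 ?(ltW c0) ?(ltW c'0)//.
- by apply: mx; rewrite r20 (lt_trans r2).
- by apply: ny; rewrite r20 (lt_trans r2).
Qed.

(** The pointwise bounds on [n] need not be uniform on [U]. *)
Lemma lower_scaling_open_conv m n (U : set (circle R)) z (s : R) :
  open U -> 0 < m U ->
  (forall y, U y -> lower_scaling n (z - y)%R s) ->
  lower_scaling (conv m n) z s.
Proof.
move=> oU mU0 H.
(* The points of [U] where the bound holds with constant [1/(i+1)] for the radii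
   [1/(l+1)] with [l >= i]; restricting to a sequence of radii makes [A i]
   measurable. *)
pose A i := U `&` \bigcap_(l in [set l | (i <= l)%N])
  [set y | (i.+1%:R^-1 * l.+1%:R^-1 `^ s)%:E <= n (ball (z - y)%R l.+1%:R^-1%R)].
have mA i : measurable (A i).
  apply: measurableI; first exact: open_measurable_circle.
  apply: bigcap_measurable; first by exists i => /=.
  move=> l _; rewrite -[X in measurable X]setTI.
  apply: emeasurable_fun_c_infty => //.
  exact: measurable_measure_ball.
have UA : U = \bigcup_i A i.
  apply/seteqP; split=> [y Uy|y [i _ []//]].
  have [c [d [c0 d0 cd]]] := H y Uy.
  have [i _ /(_ i (leqnn _)) icd] :
      \forall i \near \oo, (i.+1%:R^-1 < Num.min c d)%R.
    have cd0 : (0 < Num.min c d)%R by rewrite lt_min c0.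
    exact: near_infty_natSinv_lt (PosNum cd0).
  move: icd; rewrite lt_min => /andP[ic id].
  exists i => //; split => // l /= il.
  have li : (l.+1%:R^-1 <= i.+1%:R^-1 :> R)%R by rewrite lef_pV2 ?posrE// ler_nat.
  apply: (@le_trans _ _ (c * l.+1%:R^-1 `^ s)%:E).
    by rewrite lee_fin ler_wpM2r ?powR_ge0// ltW.
  by apply: cd; rewrite invr_gt0 ltr0n/= (le_lt_trans li).
have [i mAi] : exists i, 0 < m (A i).
  apply: contrapT => /forallNP A0.
  have nA i : m.-negligible (A i).
    apply/negligibleP => //; apply/eqP; rewrite eq_le measure_ge0 andbT leNgt.
    apply/negP; exact: A0.
  have /negligibleP := @negligible_bigcup _ _ _ m A nA.
  move=> /(_ (bigcup_measurable (fun i _ => mA i))); rewrite -UA => mU.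
  by move: mU0; rewrite mU ltxx.
have fA : m (A i) \is a fin_num by exact: fin_num_measure.
apply: (@seq_scaling _ _ _ (i.+1%:R^-1 * fine (m (A i)))%R i).
  by rewrite mulr_gt0 ?invr_gt0// fine_gt0// mAi ltey_eq fA.
move=> l il; rewrite [leRHS]conv_ball mulrAC EFinM fineK//.
apply: (@le_trans _ _ (\int[m]_(y in A i) n (ball (z - y)%R l.+1%:R^-1%R))).
  rewrite -integral_cst//; apply: ge0_le_integral => //.
  - by move=> y _; rewrite lee_fin mulr_ge0 ?powR_ge0.
  - by apply: measurable_funTS; exact: measurable_measure_ball.
  - by move=> y [_ /(_ l il)].
apply: ge0_subset_integral => //.
exact: measurable_measure_ball.
Qed.

End lower_scaling.

(** * Convolution powers *)

Section convolution_powers.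
Context {R : realType}.
Implicit Types m n p : {finite_measure set (circle R) -> \bar R}.

Lemma conv_ballC m n z (r : R) : conv m n (ball z r) = conv n m (ball z r).
Proof.
pose f (p : circle R * circle R) := ((\1_(ball z r) (p.1 + p.2)%R)%:E : \bar R).
have mf : measurable_fun setT f.
  apply/measurable_EFinP; apply: measurableT_comp measurable_circle_add.
  by apply: measurable_indic; exact: measurable_circle_ball.
have /= := @fubini_tonelli _ _ _ _ R m n f mf (fun=> ltac:(by rewrite lee_fin)).
rewrite /conv => ->; apply: eq_integral => y _; apply: eq_integral => x _.
by rewrite /f /= addrC.
Qed.

Lemma conv_ballCA m n p z (r : R) :
  conv m (conv p n) (ball z r) = conv p (conv m n) (ball z r).
Proof.
pose f (u : circle R * circle R) := n (ball (z - (u.1 + u.2))%R r).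
have mf : measurable_fun setT f.
  exact: measurableT_comp (measurable_measure_ball n z r) measurable_circle_add.
have /= fub := @fubini_tonelli _ _ _ _ R m p f mf (fun=> measure_ge0 _ _).
transitivity (\int[m]_x \int[p]_y f (x, y)).
  rewrite conv_ball; apply: eq_integral => x _.
  apply: (etrans (conv_ball _ _ _ _)); apply: eq_integral => y _.
  by rewrite /f/= opprD addrA.
rewrite fub conv_ball; apply: eq_integral => y _.
apply/esym/(etrans (conv_ball _ _ _ _)); apply: eq_integral => x _.
by rewrite /f/= opprD addrA addrAC.
Qed.

(** The convolution power [m^(k+1)] as a finite measure; the index is shifted so
that the recursion starts from [m] itself, as that of [conv_pow] does. *)
Fixpoint mpow m (k : nat) : {finite_measure set (circle R) -> \bar R} :=
  if k is k'.+1 then conv m (mpow m k') else m.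

Lemma mpowE m k : conv_pow m k.+1 = mpow m k.
Proof. by elim: k => // k IH; rewrite [RHS]/= -IH. Qed.

(** With exponents [j+1] and [k+1], the exponent of the product is [(j+k+1)+1]. *)
Lemma mpowD_ball m j k z (r : R) :
  mpow m (j + k).+1 (ball z r) = conv (mpow m k) (mpow m j) (ball z r).
Proof.
elim: j z => [|j IH] z; first exact: conv_ballC.
rewrite [RHS]conv_ballCA [LHS]conv_ball [RHS]conv_ball.
by apply: eq_integral => x _; exact: IH.
Qed.

Lemma msupp_mpowD m j k x y : msupp (mpow m j) x -> msupp (mpow m k) y ->
  msupp (mpow m (j + k).+1) (x + y)%R.
Proof.
move=> jx ky; apply/msuppP => r r0; rewrite mpowD_ball.
by move: r r0; apply/msuppP; rewrite addrC; exact: msupp_conv.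
Qed.

Lemma msupp_mpow_neq0 m j z : msupp (mpow m j) z -> exists x, msupp m x.
Proof.
case: j => [mz|j /msupp_conv_sub[x [y [mx _ _]]]]; first by exists z.
by exists x.
Qed.

(** As [(i+1)(j+1) = (i(j+1)+j)+1]. *)
Lemma msupp_mpowMn m j x i : msupp (mpow m j) x ->
  msupp (mpow m (i * j.+1 + j)) (x *+ i.+1)%R.
Proof.
move=> jx; elim: i => [|i IH]; first by rewrite mul0n add0n mulr1n.
have -> : (i.+1 * j.+1 + j = ((i * j.+1 + j) + j).+1)%N by lia.
by rewrite mulrSr; exact: msupp_mpowD.
Qed.

(** If the support contains [B(w, e)] and [1/(i+1) < e], every [z] is [i+1] times a
point [w + u/(i+1)] of that ball, where [u] in [[0, 1)] represents [z - (i+1) w]. *)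
Lemma msupp_mpow_eventually m j : (msupp (mpow m j))° !=set0 ->
  exists K, forall k, (K <= k)%N -> forall z, msupp (mpow m k) z.
Proof.
move=> [w jw].
have [e e0 we] : exists2 e : R, (0 < e)%R & ball w e `<=` msupp (mpow m j).
  by move: jw => /nbhs_ballP.
have [i _ /(_ i (leqnn _)) ie] : \forall i \near \oo, (i.+1%:R^-1 < e)%R.
  exact: near_infty_natSinv_lt (PosNum e0).
exists (i * j.+1 + j)%N => k /subnK <-.
have [x mx] : exists x, msupp m x.
  by apply: (@msupp_mpow_neq0 _ j w); apply: we; exact: ballxx.
elim: (k - _)%N => [|l IH] z; last first.
  by rewrite addSn -(subrKC x z); exact: msupp_conv.
have [u [u0 u1 uz]] := to_circle_unit_itv (z - w *+ i.+1)%R.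
have -> : z = ((w + to_circle (u / i.+1%:R)) *+ i.+1)%R.
  rewrite mulrnDl (_ : to_circle (u / i.+1%:R) *+ i.+1 = to_circle u)%R.
    by rewrite uz addrC subrK.
  by rewrite /to_circle -raddfMn -[(u / _ *+ _)%R]mulr_natr mulfVK.
apply: msupp_mpowMn; apply: we.
have [b <-] := to_circleK w; rewrite -to_circleD; apply: ball_to_circle.
rewrite opprD addrA subrr add0r normrN ger0_norm ?divr_ge0//.
apply: le_lt_trans ie; rewrite ler_piMl ?invr_ge0// ltW//.
Qed.

Lemma lower_scaling_mpow m (a : R) :
  (forall x, msupp m x -> upper_local_dim m x <= a%:E) ->
  forall j z s, msupp (mpow m j) z -> (a < s)%R ->
  lower_scaling (mpow m j) z (s * j.+1%:R).
Proof.
move=> ma j z s + as_; elim: j z => [|j IH] z.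
  by move=> mz; rewrite mulr1; exact: upper_local_dim_scaling (ma z mz) _.
move=> /msupp_conv_sub[x [y [mx jy ->]]].
rewrite -nat1r mulrDr mulr1; apply: lower_scaling_conv; last exact: IH.
exact: upper_local_dim_scaling (ma x mx) _.
Qed.

End convolution_powers.

Theorem theorem2p6 (R : realType)
    (mu : {finite_measure set (circle R) -> \bar R}) (lambda : R)
    (hdim : forall x : circle R, msupp mu x -> upper_local_dim mu x <= lambda%:E)
    (N : nat) (hN : (1 <= N)%N)
    (hint : (msupp (conv_pow mu N))° !=set0) :
  exists k0 : nat, forall k : nat, (k0 <= k)%N ->
    forall z : circle R,
      upper_local_dim (conv_pow mu (N + k)%N) z <= (lambda * N%:R)%:E.
Proof.
case: N hN hint => // j _; rewrite mpowE => hint.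
have [K HK] := @msupp_mpow_eventually _ _ _ hint.
exists K.+1 => -[//|k] Kk z; rewrite addSn addnS mpowE.
have {}Kk : (K <= k)%N by [].
have muz y : msupp (mpow mu k) y by exact: HK.
apply: scaling_upper_local_dim => [|s ls]; first by apply: HK; lia.
have ls' : (lambda < s / j.+1%:R)%R by rewrite ltr_pdivlMr.
have [w jw] := hint.
have : lower_scaling (conv (mpow mu k) (mpow mu j)) z s.
  apply: (@lower_scaling_open_conv _ _ _ [set y | (msupp (mpow mu j))° (z - y)%R]).
  - exact/circle_open_reflect/open_interior.
  - apply: (muz (z - w)%R); split; last by rewrite /= subKr.
    exact/circle_open_reflect/open_interior.
  - move=> y /interior_subset/(lower_scaling_mpow _ _ hdim)/(_ ls').
    by rewrite mulfVK.
by move=> [c [d [c0 d0 H]]]; exists c, d; split => // r rd; rewrite mpowD_ball; exact: H.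
Qed.
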